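(* Let $a,b,q\in\mathbb{C}$ with $|q|<1$ and $|bq|<|a|<1/|b|$. Then $$\frac{(a^2q,b^2q;q^4)_\infty}{(a^2q^3,b^2q^3;q^4)_\infty}=1+ab-\cfrac{(a+bq)(b+aq)}{1+q^2+\cfrac{(a-bq)(b-aq)q^2}{1+q^4-\cfrac{(a+bq^3)(b+aq^3)q^2}{1+q^6+\cfrac{(a-bq^3)(b-aq^3)q^4}{1+q^8-\cdots}}}},$$ i.e. the left side equals $1+ab+K_{k\ge1}(a_k/b_k)$ with $b_k=1+q^{2k}$ for $k\ge1$, and $a_{2n-1}=-(a+bq^{2n-1})(b+aq^{2n-1})q^{2n-2}$, $a_{2n}=(a-bq^{2n-1})(b-aq^{2n-1})q^{2n}$ for $n\ge1$.
   Context: $(x;q)_\infty=\prod_{n\ge0}(1-xq^n)$ and $(x,y;q)_\infty=(x;q)_\infty(y;q)_\infty$. For complex sequences $(a_k)_{k\ge1}$ with all $a_k\neq0$ and $(b_k)_{k\ge0}$, the continued fraction $b_0+K_{k\ge1}(a_k/b_k)=b_0+\cfrac{a_1}{b_1+\cfrac{a_2}{b_2+\cdots}}$ has value $f\in\mathbb{C}\cup\{\infty\}$ if its approximants $b_0+\cfrac{a_1}{b_1+\cdots+\cfrac{a_n}{b_n}}$ converge to $f$ as $n\to\infty$. The parameters are assumed to be such that both sides make sense: $b\neq0$, the product in the denominator on the left is nonzero, and all partial numerators $a_k$ are nonzero. *)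

(* Defs.v *)
From mathcomp Require Export all_boot all_order all_algebra.
From mathcomp Require Export all_classical all_reals all_analysis.
From mathcomp Require Export complex.
Export Order.TTheory GRing.Theory Num.Theory.
Export numFieldNormedType.Exports.

Set Implicit Arguments.
Unset Strict Implicit.
Unset Printing Implicit Defensive.

Local Open Scope classical_set_scope.
Local Open Scope ring_scope.

(* The topology on the complex numbers is carried by the alias R[i]^o. *)

Definition qpochhammer (R : realType) (x q : R[i]) : R[i] :=
  limn (fun n => \prod_(k < n) (1 - x * q ^+ k) : (R[i])^o).

(* The Riemann sphere; None is the point at infinity. *)
Definition Chat (R : realType) : topologicalType :=
  one_point_compactification (R[i])^o.

(* c + z, with c + oo = oo *)
Definition Chat_add (R : realType) (c : R[i]) (z : Chat R) : Chat R :=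
  if z is Some w then Some (c + w) else None.

(* c / z for c != 0, with c / 0 = oo and c / oo = 0 *)
Definition Chat_div (R : realType) (c : R[i]) (z : Chat R) : Chat R :=
  if z is Some w then (if w == 0 then None else Some (c / w)) else Some 0.

(* b_k + a_(k+1) / (b_(k+1) + ... + a_(k+n) / b_(k+n)), evaluated in Chat *)
Fixpoint cf_segment (R : realType) (a b : nat -> R[i]) (k n : nat) : Chat R :=
  if n is m.+1 then
    Chat_add (b k) (Chat_div (a k.+1) (cf_segment a b k.+1 m))
  else Some (b k).

Definition cf_approximant (R : realType) (a b : nat -> R[i]) (n : nat) :
  Chat R := cf_segment a b 0 n.

(* a 0 is never used. *)
Definition cf_has_value (R : realType) (a b : nat -> R[i]) (f : Chat R) :
  Prop := cf_approximant a b @ \oo --> f.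

(* For k >= 1, the n below is the one with k = 2n - 1 or k = 2n. *)
Definition cf_num (R : realType) (a b q : R[i]) (k : nat) : R[i] :=
  let n := uphalf k in
  if odd k then
    - ((a + b * q ^+ (2 * n - 1)) * (b + a * q ^+ (2 * n - 1))
       * q ^+ (2 * n - 2))
  else
    (a - b * q ^+ (2 * n - 1)) * (b - a * q ^+ (2 * n - 1)) * q ^+ (2 * n).

Definition cf_den (R : realType) (a b q : R[i]) (k : nat) : R[i] :=
  if k is 0%N then 1 + a * b else 1 + q ^+ (2 * k).

(* Main.v *)
(** Let A_n/B_n be the n-th approximant, and divide A_n and B_n by the product
    of the partial denominators 1 + q^(2k), 1 <= k <= n; as the a_k decrease
    geometrically, the quotients converge, say to A(a,b) and B(a,b). Multiplying
    both parameters by q amounts to a contiguity relation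
      A_n(aq,bq) = r_n B_n + a_(n+1) B_(n-1),
      (1 - a^2 q)(1 - b^2 q) B_n(aq,bq) = r_n A_n + a_(n+1) A_(n-1),
    where r_n = 1 - ab q^(n+1) for odd n and r_n = 1 + ab q^(n+2) for even n.
    In the limit B(a,b) = A(aq,bq) and A(a,b) = (1 - a^2 q)(1 - b^2 q) B(aq,bq),
    so A(a,b) = (1 - a^2 q)(1 - b^2 q) A(aq^2,bq^2). Since A(aq^m,bq^m) tends to
    1, iteration gives the products A(a,b) = (a^2 q, b^2 q; q^4) and
    B(a,b) = A(aq,bq) = (a^2 q^3, b^2 q^3; q^4). *)

Require Import Defs.
From mathcomp Require Import ring lra zify.

Set Implicit Arguments.
Unset Strict Implicit.
Unset Printing Implicit Defensive.

Import Normc.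

Local Open Scope classical_set_scope.
Local Open Scope ring_scope.
Local Open Scope complex_scope.

(* [Num.Theory] shadows the projections of [complex]. *)
Local Notation Re := complex.Re.
Local Notation Im := complex.Im.

(** * The three-term recurrence and its contiguity relation *)

Section Contiguity.
Variables (R : realType) (q : R[i]).
Implicit Types (a b : R[i]) (X Y : nat -> R[i]) (n : nat).

Lemma cf_numS a b n : cf_num a b q n.+1 =
  if odd n then (a - b * q ^+ n) * (b - a * q ^+ n) * q ^+ n.+1
  else - ((a + b * q ^+ n.+1) * (b + a * q ^+ n.+1) * q ^+ n).
Proof.
have := odd_double_half n; rewrite /cf_num /=.
case: (odd n) => /= nE.
  by have [-> ->] : (2 * n./2.+1 - 1 = n /\ 2 * n./2.+1 = n.+1)%N by lia.
by have [-> ->] : (2 * n./2.+1 - 1 = n.+1 /\ 2 * n./2.+1 - 2 = n)%N by lia.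
Qed.

(** Index [n] stands for the usual n - 1, so that a solution starts at A_(-1), A_0. *)
Definition cf_solution a b X := forall n,
  X n.+2 = cf_den a b q n.+1 * X n.+1 + cf_num a b q n.+1 * X n.

Definition contiguity_coef a b n : R[i] :=
  if odd n then 1 - a * b * q ^+ n.+1 else 1 + a * b * q ^+ n.+2.

(** The right-hand side satisfies the recurrence of [Y]: once reduced to [X n.+1] and [X n], this is
    a polynomial identity in a, b, q and q^n for each parity of n. Hence two initial instances
    suffice. *)
Lemma contiguity a b X Y :
    cf_solution a b X -> cf_solution (a * q) (b * q) Y ->
    Y 1%N = contiguity_coef a b 0 * X 1%N + cf_num a b q 1 * X 0%N ->
    Y 2%N = contiguity_coef a b 1 * X 2%N + cf_num a b q 2 * X 1%N ->
  forall n, Y n.+1 = contiguity_coef a b n * X n.+1 + cf_num a b q n.+1 * X n.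
Proof.
move=> solX solY Y1 Y2 n.
suff [] : Y n.+1 = contiguity_coef a b n * X n.+1 + cf_num a b q n.+1 * X n /\
  Y n.+2 = contiguity_coef a b n.+1 * X n.+2 + cf_num a b q n.+2 * X n.+1 by [].
elim: n => [//|n [IH1 IH2]]; split=> //.
rewrite solY IH1 IH2 (solX n.+1) (solX n) /cf_den !cf_numS /contiguity_coef /=.
(* All powers become polynomials in q and q^n, which [ring] treats as atoms. *)
rewrite !mulnS [(2 * n)%N]mulnC !addnS !exprS exprM.
by case: (odd n) => /=; ring.
Qed.

End Contiguity.

(** * Convergence of complex sequences by real estimates *)

Section ComplexSequences.
Variable R : realType.
Implicit Types (x y z : R[i]) (X : nat -> R[i]).

Lemma normr_normc x : `|x| = (normc x)%:C.
Proof. by case: x. Qed.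

Lemma normc_ge0 x : 0 <= normc x.
Proof. by rewrite -ler0c -normr_normc normr_ge0. Qed.

Lemma normcX x n : normc (x ^+ n) = normc x ^+ n.
Proof. by apply: complexI; rewrite rmorphXn -!normr_normc normrX. Qed.

Lemma le_normcB x y : normc (x - y) <= normc x + normc y.
Proof. by rewrite -(normcN y) le_normcD. Qed.

Lemma normc_distC x y : normc (x - y) = normc (y - x).
Proof. by rewrite -normcN opprB. Qed.

Lemma normr_Re_le_normc x : `|Re x| <= normc x.
Proof. by rewrite -lecR -normr_normc normc_ge_Re. Qed.

Lemma normr_Im_le_normc x : `|Im x| <= normc x.
Proof.
by case: x => u v /=; rewrite -sqrtr_sqr ler_wsqrtr // lerDr sqr_ge0.
Qed.

Lemma normc_le_ReIm x : normc x <= `|Re x| + `|Im x|.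
Proof.
rewrite [x in normc x]complexE; apply: le_trans (le_normcD _ _) _.
rewrite normcM /= !expr0n /= !addr0 add0r expr1n sqrtr1 mul1r.
by rewrite !sqrtr_sqr.
Qed.

Lemma cvg_normcP X (l : R[i]) : X @ \oo --> (l : R[i]^o) <->
  normc (X n - l) @[n --> \oo] --> (0 : R).
Proof.
have distP := @cvgrPdist_le _ (R[i])^o _ _ _ (X : nat -> (R[i])^o) l.
split => [/distP Xl|Xl].
  apply/cvgrPdist_le => /= e e0; near=> n.
  rewrite sub0r normrN ger0_norm ?normc_ge0// -lecR -normr_normc distrC.
  by near: n; apply: Xl; rewrite ltcR.
apply/distP => /= e e0.
(* The radius [e] lives in [R[i]]; being positive, it is real. *)
have eE : e = (Re e)%:C by rewrite RRe_real // gtr0_real.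
have {}e0 : 0 < Re e by rewrite -ltcR -eE.
near=> n; rewrite eE distrC normr_normc lecR -[leLHS]ger0_norm ?normc_ge0//.
rewrite -normrN -sub0r; near: n.
by move/cvgrPdist_le : Xl; apply.
Unshelve. all: by end_near. Qed.

Lemma cvg_ReIm X (u v : R) : Re (X n) @[n --> \oo] --> u ->
  Im (X n) @[n --> \oo] --> v -> X @ \oo --> ((u +i* v) : R[i]^o).
Proof.
move=> Xu Xv; apply/cvg_normcP.
have uvX : `|Re (X n) - u| + `|Im (X n) - v| @[n --> \oo] --> (0 : R).
  rewrite -[0]addr0; apply: cvgD; rewrite -(@normr0 _ R); apply: cvg_norm.
    by rewrite -(subrr u); apply: cvgB => //; exact: cvg_cst.
  by rewrite -(subrr v); apply: cvgB => //; exact: cvg_cst.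
apply: (squeeze_cvgr _ (cvg_cst 0) uvX); near=> n.
by rewrite normc_ge0 /=; case: (X n) => s t; exact: normc_le_ReIm.
Unshelve. all: by end_near. Qed.

(** Both [E] and [x + E] are nondecreasing and bounded above, and [x] is their difference. *)
Lemma is_cvg_dominated_increments (x E : nat -> R) (K : R) :
    (forall n, `|x n.+1 - x n| <= E n.+1 - E n) -> (forall n, E n <= K) ->
  cvgn x.
Proof.
move=> xE EK.
have inc : nondecreasing_seq (x \+ E).
  by apply/nondecreasing_seqP => n /=; have := xE n; rewrite ler_norml; lra.
have incE : nondecreasing_seq E.
  apply/nondecreasing_seqP => n /=; rewrite -subr_ge0.
  exact: le_trans (xE n).
have xEK n : x n <= x 0%N - E 0%N + E n.
  by elim: n => [|n IH]; [lra | have := xE n; rewrite ler_norml; lra].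
have cE : cvgn E by apply: nondecreasing_is_cvgn => //; exists K => _ [n _ <-].
have cxE : cvgn (x \+ E).
  apply: nondecreasing_is_cvgn => //.
  exists (x 0%N - E 0%N + K + K) => _ [n _ <-] /=.
  by have := xEK n; have := EK n; lra.
have -> : x = (x \+ E) \- E by apply/funext => n /=; lra.
exact: is_cvgB.
Qed.

Lemma prod1D_le_expR (c r : R) n : 0 <= c -> 0 <= r < 1 ->
  \prod_(k < n) (1 + c * r ^+ k) <= expR (c / (1 - r)).
Proof.
move=> c0 /andP[r0 r1]; have r1' : 0 < 1 - r by lra.
(* The induction needs the exact partial geometric sum in the exponent; each factor is bounded by 1
   + t <= exp t. *)
apply: (@le_trans _ _ (expR (c * (1 - r ^+ n) / (1 - r)))); last first.
  rewrite ler_expR ler_pM2r ?invr_gt0// ler_piMr// lerBlDr lerDl.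
  exact: exprn_ge0.
elim: n => [|n IH]; first by rewrite big_ord0 expr0 subrr mulr0 mul0r expR0.
rewrite big_ord_recr /=.
have -> : c * (1 - r ^+ n.+1) / (1 - r) =
    c * (1 - r ^+ n) / (1 - r) + c * r ^+ n.
  by rewrite exprS; field; rewrite gt_eqF.
rewrite expRD; apply: ler_pM => //; last exact: expR_ge1Dx.
  by apply: prodr_ge0 => k _; rewrite addr_ge0// mulr_ge0// exprn_ge0.
by rewrite addr_ge0// mulr_ge0// exprn_ge0.
Qed.

(* Comparison with the solution E n of E (n+1) - E n = c r^n E n. *)
Lemma cvg_geometric_increments X (c r : R) : 0 <= c -> 0 <= r < 1 ->
    (forall n M, (forall k, (k <= n)%N -> normc (X k) <= M) ->
      normc (X n.+1 - X n) <= c * r ^+ n * M) ->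
  exists2 l : R[i], X @ \oo --> (l : R[i]^o) &
    normc (l - X 0%N) <= normc (X 0%N) * (expR (c / (1 - r)) - 1).
Proof.
move=> c0 r01 incX; have /andP[r0 r1] := r01.
pose E n := normc (X 0%N) * \prod_(k < n) (1 + c * r ^+ k).
have cr0 k : 0 <= c * r ^+ k by rewrite mulr_ge0// exprn_ge0.
have ES n : E n.+1 - E n = c * r ^+ n * E n by rewrite /E big_ord_recr /=; ring.
have E0 n : 0 <= E n.
  by rewrite mulr_ge0 ?normc_ge0// prodr_ge0// => k _; rewrite addr_ge0.
have E_le : {homo E : m n / (m <= n)%N >-> m <= n}.
  by apply/nondecreasing_seqP => n; rewrite -subr_ge0 ES mulr_ge0.
have E_bnd n : E n <= normc (X 0%N) * expR (c / (1 - r)).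
  by rewrite ler_wpM2l ?normc_ge0// prod1D_le_expR.
(* The two bounds feed each other: the first up to n gives the increment at n, and adding it gives
   the first at n + 1. *)
have XE n : normc (X n) <= E n /\ normc (X n.+1 - X n) <= E n.+1 - E n.
  suff XE : forall k, (k <= n)%N -> normc (X k) <= E k.
    split; first exact: XE.
    by rewrite ES; apply: incX => k kn; apply: le_trans (XE _ kn) (E_le _ _ kn).
  elim: n => [|n IH] k.
    by rewrite leqn0 => /eqP ->; rewrite /E big_ord0 mulr1.
  rewrite leq_eqVlt => /predU1P[->|]; last exact: IH.
  have : normc (X n.+1 - X n) <= E n.+1 - E n.
    by rewrite ES; apply: incX => i ni; apply: le_trans (IH _ ni) (E_le _ _ ni).
  have := le_normcD (X n.+1 - X n) (X n); rewrite subrK.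
  by have := IH n (leqnn n); lra.
have XX0 n : normc (X n - X 0%N) <= E n - E 0%N.
  elim: n => [|n IH]; first by rewrite !subrr normc0.
  have := le_normcD (X n.+1 - X n) (X n - X 0%N); rewrite addrA subrK.
  by have [_] := XE n; lra.
have cRe : cvgn (fun n => Re (X n)).
  apply: (@is_cvg_dominated_increments _ E) E_bnd => n.
  apply: le_trans (XE n).2; rewrite -[_ - _]/(_ - _) -raddfB.
  exact: normr_Re_le_normc.
have cIm : cvgn (fun n => Im (X n)).
  apply: (@is_cvg_dominated_increments _ E) E_bnd => n.
  apply: le_trans (XE n).2; rewrite -raddfB.
  exact: normr_Im_le_normc.
have Xl := cvg_ReIm cRe cIm; set l := (_ +i* _) in Xl.
(* The bound on [l - X 0] is the one on [X N - X 0], up to an arbitrary error [e]. *)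
exists l => //; apply/ler_addgt0Pr => e e0.
have /cvgrPdist_le/(_ e e0)[N _ /(_ N (leqnn N))] := (cvg_normcP X l).1 Xl.
rewrite /= sub0r normrN ger0_norm ?normc_ge0// normc_distC => lN.
have := le_normcD (l - X N) (X N - X 0%N); rewrite addrA subrK.
have := XX0 N; have := E_bnd N; rewrite {3}/E big_ord0 mulr1 mulrBr mulr1; lra.
Qed.

End ComplexSequences.

(** * Limit rules in [R[i]] and convergence of the infinite products *)

Section QPochhammer.
Variable R : realType.
Implicit Types (x p : R[i]) (X Y : nat -> R[i]).

Lemma normc_lt1 x : `|x| < 1 -> 0 <= normc x < 1.
Proof. by rewrite normc_ge0 -ltcR -normr_normc. Qed.

Lemma limn_complex X (l : R[i]) : X @ \oo --> (l : R[i]^o) ->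
  limn (X : nat -> R[i]^o) = l.
Proof.
move=> Xl; apply: (@cvg_lim (R[i])^o) Xl.
exact: (@norm_hausdorff _ (R[i])^o).
Qed.

Lemma cvg_shiftS_complex X (l : R[i]) :
  (fun n => X n.+1) @ \oo --> (l : R[i]^o) <-> X @ \oo --> (l : R[i]^o).
Proof.
rewrite (cvg_normcP X) (cvg_normcP (fun n => X n.+1)).
by rewrite -(cvg_shiftS (fun n => normc (X n - l))).
Qed.

Lemma cvgD_complex X Y (x y : R[i]) : X @ \oo --> (x : R[i]^o) ->
  Y @ \oo --> (y : R[i]^o) ->
  (fun n => X n + Y n) @ \oo --> ((x + y : R[i]) : R[i]^o).
Proof. exact: (@cvgD _ (R[i])^o). Qed.

Lemma cvgM_complex X Y (x y : R[i]) : X @ \oo --> (x : R[i]^o) ->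
  Y @ \oo --> (y : R[i]^o) ->
  (fun n => X n * Y n) @ \oo --> ((x * y : R[i]) : R[i]^o).
Proof. exact: (@cvgM R[i] nat _ eventually_filter X Y x y). Qed.

Lemma cvgV_complex X (x : R[i]) : x != 0 -> X @ \oo --> (x : R[i]^o) ->
  (fun n => (X n)^-1) @ \oo --> ((x^-1 : R[i]) : R[i]^o).
Proof. exact: (@cvgV R[i] nat _ eventually_filter X x). Qed.

Lemma cvg_cst_complex (x : R[i]) : (fun=> x) @ \oo --> (x : R[i]^o).
Proof. exact: (@cvg_cst (R[i])^o). Qed.

Lemma cvg_geometric_bound X (c r : R) : 0 <= r < 1 ->
  (forall n, normc (X n) <= c * r ^+ n) -> X @ \oo --> ((0 : R[i]) : R[i]^o).
Proof.
move=> /andP[r0 r1] Xc; apply/cvg_normcP.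
have cr : c * r ^+ n @[n --> \oo] --> (0 : R).
  rewrite -(mulr0 c); apply: cvgM; first exact: cvg_cst.
  by apply: cvg_expr; rewrite ger0_norm.
apply: (squeeze_cvgr _ (cvg_cst 0) cr); apply: nearW => n.
by rewrite normc_ge0 subr0 Xc.
Qed.

(** The increment of the partial products at n is -x p^n times the n-th product, a geometric
    increment with ratio |p|. *)
Lemma cvg_qpochhammer x p : `|p| < 1 ->
  (fun n => \prod_(k < n) (1 - x * p ^+ k)) @ \oo
    --> (qpochhammer x p : R[i]^o).
Proof.
move=> /normc_lt1 p1.
have [|l Xl _] := @cvg_geometric_increments _
  (fun n => \prod_(k < n) (1 - x * p ^+ k)) _ _ (normc_ge0 x) p1.
  move=> n M XM; rewrite big_ord_recr /=.
  set P := \prod_(_ < _) _.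
  have -> : P * (1 - x * p ^+ n) - P = - (x * p ^+ n * P) by ring.
  rewrite normcN !normcM normcX ler_wpM2l ?mulr_ge0 ?exprn_ge0 ?normc_ge0//.
  exact: XM.
by rewrite /qpochhammer (limn_complex Xl).
Qed.

End QPochhammer.

(** * Limits of the normalized numerators and denominators *)

Section Limits.
Variables (R : realType) (q : R[i]).
Hypotheses (q_lt1 : `|q| < 1) (q_neq0 : q != 0).
Implicit Types (a b : R[i]) (X Y : nat -> R[i]) (n : nat).

Let r := normc q.

Let r01 : 0 < r < 1.
Proof.
rewrite lt_def normc_ge0 andbT -ltcR -normr_normc q_lt1 andbT.
by apply: contra q_neq0 => /eqP /eq0_normc ->.
Qed.

Let r_ge0 n : 0 <= r ^+ n.
Proof. by rewrite exprn_ge0// normc_ge0. Qed.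

Let r_le1 n : r ^+ n <= 1.
Proof. by rewrite exprn_ile1 ?normc_ge0//; case/andP: r01 => _ /ltW. Qed.

(** Both linear factors are at most |a| + |b| in modulus, and the remaining power of q has exponent
    n or n + 1. *)
Lemma normc_cf_num a b n :
  normc (cf_num a b q n.+1) <= (normc a + normc b) ^+ 2 * r ^+ n.
Proof.
have r1 : r ^+ n.+1 <= r ^+ n.
  by rewrite exprS ler_piMl// ltW//; case/andP: r01.
rewrite cf_numS; case: ifP => _; rewrite ?normcN !normcM normcX expr2;
  (apply: ler_pM; [by rewrite mulr_ge0 ?normc_ge0|exact: r_ge0| |by []]);
  rewrite [X in _ <= _ * X]addrC; apply: ler_pM; rewrite ?normc_ge0//.
- apply: le_trans (le_normcB _ _) _; rewrite normcM normcX lerD2l.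
  by rewrite ler_piMr ?normc_ge0 ?r_le1.
- apply: le_trans (le_normcB _ _) _; rewrite normcM normcX lerD2l.
  by rewrite ler_piMr ?normc_ge0 ?r_le1.
- apply: le_trans (le_normcD _ _) _; rewrite normcM normcX lerD2l.
  by rewrite ler_piMr ?normc_ge0 ?r_le1.
- apply: le_trans (le_normcD _ _) _; rewrite normcM normcX lerD2l.
  by rewrite ler_piMr ?normc_ge0 ?r_le1.
Qed.

(** Follows the shifted indices: [den_prod n.+1] is b_1 ... b_n, and the products at 0 and 1 are
    empty. *)
Definition den_prod n : R[i] := \prod_(1 <= k < n) (1 + q ^+ (2 * k)).

Let den_ge n : 1 - r <= normc (1 + q ^+ (2 * n.+1)).
Proof.
have := le_normcB (1 + q ^+ (2 * n.+1)) (q ^+ (2 * n.+1)).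
rewrite addrK normc1 normcX -/r.
have : r ^+ (2 * n.+1) <= r.
  by rewrite mulnS exprS ler_piMr ?r_le1// ltW; case/andP: r01.
lra.
Qed.

Lemma den_prodS n : den_prod n.+2 = den_prod n.+1 * (1 + q ^+ (2 * n.+1)).
Proof. by rewrite /den_prod big_nat_recr. Qed.

Lemma den_prod0 : den_prod 0 = 1. Proof. by rewrite /den_prod big_geq. Qed.

Lemma den_prod1 : den_prod 1 = 1. Proof. by rewrite /den_prod big_geq. Qed.

Let den_neq0 n : 1 + q ^+ (2 * n.+1) != 0 :> R[i].
Proof.
apply/eqP => d0; have := den_ge n; rewrite d0 normc0.
by case/andP: r01 => _; lra.
Qed.

Lemma den_prod_neq0 n : den_prod n != 0.
Proof.
case: n => [|n]; first by rewrite den_prod0 oner_neq0.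
by elim: n => [|n IH]; rewrite ?den_prod1 ?oner_neq0// den_prodS mulf_neq0.
Qed.

Definition normalized X n := X n / den_prod n.

Lemma den_ratio n : exists2 d : R[i], den_prod n.+1 = d * den_prod n &
  1 - r <= normc d.
Proof.
case: n => [|n].
  by exists 1; rewrite ?den_prod0 ?den_prod1 ?mulr1// normc1;
    case/andP: r01; lra.
by exists (1 + q ^+ (2 * n.+1)); rewrite ?den_prodS 1?mulrC.
Qed.

(* The increment bound is needed with r ^+ n.+1, hence the extra 1 / r. *)
Definition growth a b : R := (normc a + normc b) ^+ 2 / ((1 - r) ^+ 2 * r).

Lemma growth_ge0 a b : 0 <= growth a b.
Proof.
case/andP: r01 => r0 r1; apply: divr_ge0; first exact: sqr_ge0.
by rewrite mulr_ge0 ?sqr_ge0 ?ltW.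
Qed.

Let growthX_ge0 a b n : 0 <= growth a b * r ^+ n.
Proof. exact: mulr_ge0 (growth_ge0 _ _) (r_ge0 _). Qed.

(** After division by [den_prod n.+2] the first term of the recurrence is exactly
    [normalized X n.+1]. What remains is a partial numerator over two factors of modulus at least 1
    - r. *)
Lemma normalized_increment a b X n : cf_solution q a b X ->
  normc (normalized X n.+2 - normalized X n.+1) <=
    growth a b * r ^+ n.+1 * normc (normalized X n).
Proof.
move=> solX; case/andP: r01 => r0 r1.
have [d zd d_ge] := den_ratio n.
have z0 := den_prod_neq0 n; have z1 := den_prod_neq0 n.+1.
have d0 : d != 0 by apply: contraTneq z1 => dE; rewrite zd dE mul0r eqxx.
rewrite /normalized solX /cf_den den_prodS zd.
set v := cf_num _ _ _ _; set e := 1 + q ^+ _.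
have e0 : e != 0 by exact: den_neq0.
have -> : (e * X n.+1 + v * X n) / (d * den_prod n * e) -
    X n.+1 / (d * den_prod n) = v / (d * e) * (X n / den_prod n).
  by field; rewrite d0 e0 z0.
rewrite normcM ler_wpM2r ?normc_ge0// normcM normcV normcM.
have -> : growth a b * r ^+ n.+1 =
    (normc a + normc b) ^+ 2 * r ^+ n * ((1 - r) ^+ 2)^-1.
  by rewrite /growth (exprS r); field; rewrite !gt_eqF//; lra.
have de : (1 - r) ^+ 2 <= normc d * normc e.
  by rewrite expr2 ler_pM ?den_ge//; lra.
apply: ler_pM; rewrite ?invr_ge0 ?mulr_ge0 ?normc_ge0 ?normc_cf_num//.
rewrite lef_pV2// posrE ?exprn_gt0 ?subr_gt0//.
by apply: lt_le_trans de; rewrite exprn_gt0// subr_gt0.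
Qed.

Fixpoint cf_seq a b x0 x1 n : R[i] :=
  if n is n'.+1 then
    if n' is m.+1 then
      cf_den a b q n' * cf_seq a b x0 x1 n' +
      cf_num a b q n' * cf_seq a b x0 x1 m
    else x1
  else x0.

Lemma cf_seq_solution a b x0 x1 : cf_solution q a b (cf_seq a b x0 x1).
Proof. by []. Qed.

(* Canonical numerators and denominators, with indices shifted by one: cf_A n
   and cf_B n are the usual A_(n-1) and B_(n-1). *)
Definition cf_A a b := cf_seq a b 1 (1 + a * b).
Definition cf_B a b := cf_seq a b 0 1.

Definition lim_A a b : R[i] := limn (normalized (cf_A a b) : nat -> R[i]^o).
Definition lim_B a b : R[i] := limn (normalized (cf_B a b) : nat -> R[i]^o).

(** The sequence starts at 1, so the increment estimate also bounds the distance of the limit from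
    1, which controls the tail of the iteration. *)
Lemma cvg_cf_A a b : normalized (cf_A a b) @ \oo --> (lim_A a b : R[i]^o) /\
  normc (lim_A a b - 1) <= expR (growth a b / (1 - r)) - 1.
Proof.
case/andP: r01 => r0 r1.
have [||l Al] := @cvg_geometric_increments _ (normalized (cf_A a b))
  (growth a b) r (growth_ge0 a b).
- by rewrite ltW.
- move=> [|n] M XM; last first.
    apply: le_trans (normalized_increment n (@cf_seq_solution a b _ _)) _.
    by rewrite ler_wpM2l ?growthX_ge0//; exact: XM.
  (* The first increment is ab, outside the recurrence; it is bounded through |ab| <= (|a| + |b|)^2
     and (1 - r)^2 r <= 1 <= M. *)
  have := XM 0%N (leqnn _).
  rewrite /normalized /= den_prod0 den_prod1 !invr1 !mulr1 normc1 => M1.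
  rewrite addrC addKr normcM.
  apply: (@le_trans _ _ (growth a b)); last first.
    by rewrite ler_peMr// growth_ge0.
  rewrite /growth ler_pdivlMr ?mulr_gt0 ?exprn_gt0 ?subr_gt0//.
  have s0 : 0 <= (1 - r) ^+ 2 * r by rewrite mulr_ge0 ?sqr_ge0 ?ltW.
  have s1 : (1 - r) ^+ 2 * r <= 1 by nra.
  have := normc_ge0 a; have := normc_ge0 b; set u := normc a; set w := normc b.
  move=> w0 u0; apply: (@le_trans _ _ (u * w)); last by nra.
  by rewrite ler_piMr// mulr_ge0.
rewrite /lim_A (limn_complex Al) /normalized /= den_prod0 divr1 normc1 mul1r.
by split.
Qed.

(** The increment estimate fails from the initial value 0, so it is applied from index 1 on, where
    the value is 1 and the first increment vanishes. *)
Lemma cvg_cf_B a b : normalized (cf_B a b) @ \oo --> (lim_B a b : R[i]^o).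
Proof.
case/andP: r01 => r0 r1.
have [||l Bl _] := @cvg_geometric_increments _
  (fun n => normalized (cf_B a b) n.+1) (growth a b) r (growth_ge0 a b).
- by rewrite ltW.
- move=> [|n] M XM.
    rewrite /normalized den_prodS den_prod1 mul1r divr1 /cf_B /=.
    rewrite mulr0 addr0 mulr1 mulfV ?den_neq0// subrr normc0.
    apply: mulr_ge0; first exact: growthX_ge0.
    exact: le_trans (normc_ge0 _) (XM 0%N (leqnn _)).
  apply: le_trans (normalized_increment n.+1 (@cf_seq_solution a b _ _)) _.
  apply: (@le_trans _ _ (growth a b * r ^+ n.+2 * M)).
    by rewrite ler_wpM2l ?growthX_ge0//; exact: XM.
  rewrite ler_wpM2r//; first exact: le_trans (normc_ge0 _) (XM n (leqnSn n)).
  rewrite ler_wpM2l ?growth_ge0// [leLHS]exprS ler_piMl ?r_ge0//; exact: ltW.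
have Bl' : normalized (cf_B a b) @ \oo --> (l : R[i]^o).
  exact: (cvg_shiftS_complex (normalized (cf_B a b)) _).1 Bl.
by rewrite /lim_B (limn_complex Bl').
Qed.

(** After normalization the coefficient of [X n.+1] tends to 1 and that of [X n] to 0, both
    geometrically. *)
Lemma cvg_contiguity a b X Y (x y : R[i]) :
    (forall n, Y n.+1 =
      contiguity_coef q a b n * X n.+1 + cf_num a b q n.+1 * X n) ->
    normalized X @ \oo --> (x : R[i]^o) ->
    normalized Y @ \oo --> (y : R[i]^o) ->
  y = x.
Proof.
move=> YX Xx Yy; case/andP: r01 => r0 r1.
have r01' : 0 <= r < 1 by rewrite ltW.
pose u n := contiguity_coef q a b n - 1.
pose v n := cf_num a b q n.+1 * den_prod n / den_prod n.+1.
have u0 : u @ \oo --> ((0 : R[i]) : R[i]^o).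
  apply: (@cvg_geometric_bound _ _ (normc (a * b)) r) => // n.
  rewrite /u /contiguity_coef; case: ifP => _; rewrite addrC addKr ?normcN;
    rewrite normcM normcX ler_wpM2l ?normc_ge0// -/r !exprS ?mulrA.
    by rewrite ler_piMl// ltW.
  by rewrite ler_piMl// mulr_ile1// ltW.
have v0 : v @ \oo --> ((0 : R[i]) : R[i]^o).
  apply: (@cvg_geometric_bound _ _
    ((normc a + normc b) ^+ 2 / (1 - r)) r) => // n.
  have [d zd d_ge] := den_ratio n.
  have z0 := den_prod_neq0 n; have z1 := den_prod_neq0 n.+1.
  have d0 : d != 0 by apply: contraTneq z1 => dE; rewrite zd dE mul0r eqxx.
  rewrite /v zd.
  have -> : cf_num a b q n.+1 * den_prod n / (d * den_prod n) =
    cf_num a b q n.+1 / d by field; rewrite d0 z0.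
  rewrite normcM normcV mulrAC; apply: ler_pM; rewrite ?invr_ge0 ?normc_ge0//.
    exact: normc_cf_num.
  rewrite lef_pV2 ?posrE ?subr_gt0//; apply: lt_le_trans d_ge; lra.
have XS : (fun n => normalized X n.+1) @ \oo --> (x : R[i]^o).
  exact: (cvg_shiftS_complex (normalized X) _).2 Xx.
have YS : (fun n => normalized Y n.+1) @ \oo --> (y : R[i]^o).
  exact: (cvg_shiftS_complex (normalized Y) _).2 Yy.
have YE : (fun n => normalized Y n.+1) =
    (fun n => (1 + u n) * normalized X n.+1 + v n * normalized X n).
  apply/funext => n; rewrite /normalized YX /u /v.
  have z0 := den_prod_neq0 n; have z1 := den_prod_neq0 n.+1.
  by field; rewrite z0 z1.
rewrite -(limn_complex YS) YE; apply: limn_complex.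
have xE : x = (1 + 0) * x + 0 * x by ring.
rewrite [in X in _ --> X]xE.
apply: cvgD_complex (cvgM_complex v0 Xx).
exact: cvgM_complex (cvgD_complex (@cvg_cst_complex _ 1) u0) XS.
Qed.

Lemma lim_B_shift a b : lim_B a b = lim_A (a * q) (b * q).
Proof.
have con : forall n, cf_A (a * q) (b * q) n.+1 =
    contiguity_coef q a b n * cf_B a b n.+1 + cf_num a b q n.+1 * cf_B a b n.
  apply: contiguity => //; rewrite /contiguity_coef /cf_A /cf_B /=.
    by ring.
  by rewrite !cf_numS /cf_den /= muln1; ring.
exact: esym (cvg_contiguity con (@cvg_cf_B a b) (cvg_cf_A _ _).1).
Qed.

(** A constant multiple of [cf_B] still solves the linear recurrence, so contiguity applies with the
    factor [P] absorbed in [Y], without dividing by it. *)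
Lemma lim_A_shift a b :
  lim_A a b = (1 - a ^+ 2 * q) * (1 - b ^+ 2 * q) * lim_B (a * q) (b * q).
Proof.
set P := (1 - a ^+ 2 * q) * (1 - b ^+ 2 * q).
have PB : normalized (fun n => P * cf_B (a * q) (b * q) n) @ \oo -->
    ((P * lim_B (a * q) (b * q) : R[i]) : R[i]^o).
  have -> : normalized (fun n => P * cf_B (a * q) (b * q) n) =
      (fun n => P * normalized (cf_B (a * q) (b * q)) n).
    by apply/funext => n; rewrite /normalized mulrA.
  exact: cvgM_complex (@cvg_cst_complex _ P) (@cvg_cf_B _ _).
have con : forall n, P * cf_B (a * q) (b * q) n.+1 =
    contiguity_coef q a b n * cf_A a b n.+1 + cf_num a b q n.+1 * cf_A a b n.
  apply: (contiguity (Y := fun n => P * cf_B (a * q) (b * q) n)) => [|n||];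
    rewrite /P /contiguity_coef /cf_A /cf_B //=.
  - by ring.
  - by rewrite cf_numS /=; ring.
  - by rewrite !cf_numS /cf_den /= muln1; ring.
exact: esym (cvg_contiguity con (cvg_cf_A a b).1 PB).
Qed.

(** A double shift multiplies a and b by q^2, hence a^2 q and b^2 q by q^4, the base of the
    products. *)
Lemma lim_A_shift_iter a b n : lim_A a b =
  \prod_(k < n) (1 - a ^+ 2 * q * (q ^+ 4) ^+ k) *
  \prod_(k < n) (1 - b ^+ 2 * q * (q ^+ 4) ^+ k) *
  lim_A (a * q ^+ (2 * n)) (b * q ^+ (2 * n)).
Proof.
elim: n => [|n IH]; first by rewrite !big_ord0 muln0 expr0 !mulr1 !mul1r.
rewrite IH !big_ord_recr /= (lim_A_shift (a * q ^+ _)) lim_B_shift.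
rewrite (_ : 2 * n.+1 = (2 * n).+2)%N; last by lia.
rewrite -![_ * q ^+ _ * q]mulrA -!exprSr -![_ * q ^+ _ * q]mulrA -!exprSr.
have -> : (q ^+ 4) ^+ n = q ^+ (2 * n) ^+ 2.
  by rewrite -!exprM; congr (_ ^+ _); lia.
ring.
Qed.

(** [growth] is quadratic in the parameters, so the shift scales it by r^(4n), and the bound on the
    distance from 1 tends to exp 0 - 1. *)
Lemma cvg_lim_A_shift a b :
  (fun n => lim_A (a * q ^+ (2 * n)) (b * q ^+ (2 * n))) @ \oo -->
    ((1 : R[i]) : R[i]^o).
Proof.
case/andP: r01 => r0 r1.
apply/cvg_normcP.
pose K := growth a b / (1 - r).
have eK : expR (K * (r ^+ 4) ^+ n) - 1 @[n --> \oo] --> (0 : R).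
  rewrite -[0](subrr 1); apply: cvgB; last exact: cvg_cst.
  rewrite -expR0; apply: continuous_cvg; first exact: continuous_expR.
  rewrite -[0](mulr0 K); apply: cvgM; first exact: cvg_cst.
  apply: cvg_expr; rewrite ger0_norm ?exprn_ge0 ?ltW//.
  by rewrite exprn_ilt1// ltW.
apply: (squeeze_cvgr _ (cvg_cst 0) eK); apply: nearW => n.
rewrite normc_ge0 /=; apply: le_trans (cvg_cf_A _ _).2 _.
rewrite (_ : growth _ _ / _ = K * (r ^+ 4) ^+ n)//.
have -> : (r ^+ 4) ^+ n = r ^+ (2 * n) ^+ 2.
  by rewrite -!exprM; congr (_ ^+ _); lia.
by rewrite /K /growth !normcM normcX -/r; ring.
Qed.

Lemma q4_lt1 : `|q ^+ 4| < 1.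
Proof. by rewrite normrX exprn_ilt1. Qed.

Lemma lim_AE a b : lim_A a b =
  qpochhammer (a ^+ 2 * q) (q ^+ 4) * qpochhammer (b ^+ 2 * q) (q ^+ 4).
Proof.
have := cvgM_complex (cvgM_complex (@cvg_qpochhammer _ (a ^+ 2 * q) _ q4_lt1)
  (@cvg_qpochhammer _ (b ^+ 2 * q) _ q4_lt1)) (@cvg_lim_A_shift a b).
rewrite mulr1 => /limn_complex <-; apply/esym/limn_complex.
rewrite (_ : (fun n => _) = (fun=> lim_A a b)); last first.
  by apply/funext => n; rewrite -lim_A_shift_iter.
exact: cvg_cst_complex.
Qed.

Lemma lim_BE a b : lim_B a b =
  qpochhammer (a ^+ 2 * q ^+ 3) (q ^+ 4) *
  qpochhammer (b ^+ 2 * q ^+ 3) (q ^+ 4).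
Proof.
have sq (c : R[i]) : (c * q) ^+ 2 * q = c ^+ 2 * q ^+ 3 by ring.
by rewrite lim_B_shift lim_AE !sq.
Qed.

End Limits.

(** * Approximants on the Riemann sphere as quotients of solutions *)

Section Approximants.
Variable R : realType.
Implicit Types (a b X : nat -> R[i]) (n k : nat).

(** Homogeneous coordinates (u : v) of [cf_segment], with v = 0 at infinity. *)
Fixpoint segment_pair a b k n : R[i] * R[i] :=
  if n is m.+1 then
    let: (u, v) := segment_pair a b k.+1 m in (b k * u + a k.+1 * v, u)
  else (b k, 1).

(** The second clause, that u and v never vanish together, carries the induction; it persists
    because the partial numerators are nonzero. *)
Lemma cf_segmentE a b : (forall k, (0 < k)%N -> a k != 0) -> forall n k,
  let: (u, v) := segment_pair a b k n in
  cf_segment a b k n = (if v == 0 then None else Some (u / v)) /\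
  ((v == 0) ==> (u != 0)).
Proof.
move=> a_neq0; elim=> [|n IH] k /=; first by rewrite oner_eq0 divr1.
case: (segment_pair _ _ _ _) (IH k.+1) => u v [-> uv].
(* If v = 0 the tail is infinite and the segment is b_k; if u = 0 the tail is 0 and the segment is
   infinite. *)
have [v0|v0] := eqVneq v 0.
  have u0 : u != 0 by move: uv; rewrite v0 eqxx.
  by rewrite v0 /= (negbTE u0) mulr0 !addr0 mulfK.
rewrite /= mulf_eq0 invr_eq0 (negbTE v0) orbF.
have [u0|u0] := eqVneq u 0.
  by rewrite u0 mulr0 add0r mulf_neq0// a_neq0.
by split=> //=; congr Some; field; rewrite u0 v0.
Qed.

(** Links the evaluation of a segment from its tail to the forward recurrence: the pair gives the
    coefficients of a later term in two consecutive earlier ones. *)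
Lemma segment_pair_solution a b X n k :
    (forall j, X j.+2 = b j.+1 * X j.+1 + a j.+1 * X j) ->
  let: (u, v) := segment_pair a b k.+1 n in
  X (k + n).+2 = u * X k.+1 + v * a k.+1 * X k.
Proof.
move=> solX; elim: n k => [|n IH] k /=; first by rewrite addn0 solX mul1r.
case: (segment_pair _ _ _ _) (IH k.+1) => u v /=.
by rewrite addnS -addSn => ->; rewrite solX; ring.
Qed.

End Approximants.

Lemma cf_approximantE (R : realType) (a b q : R[i]) n :
    (forall k, (0 < k)%N -> cf_num a b q k != 0) -> cf_B q a b n.+1 != 0 ->
  cf_approximant (cf_num a b q) (cf_den a b q) n =
    Some (cf_A q a b n.+1 / cf_B q a b n.+1).
Proof.
move=> num_neq0; case: n => [|n] B0; first by rewrite /cf_A /cf_B /= divr1.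
have := segment_pair_solution n 0 (cf_seq_solution q a b 1 (1 + a * b)).
have := segment_pair_solution n 0 (cf_seq_solution q a b 0 1).
have := cf_segmentE (cf_den a b q) num_neq0 n.+1 0.
rewrite /cf_approximant -/(cf_A q a b) -/(cf_B q a b).
rewrite [segment_pair _ _ _ n.+1]/=; case: (segment_pair _ _ _ _) => u v.
(* The initial values 0 and 1 of [cf_B] identify u with the denominator. *)
rewrite add0n [X in _ = _ * X + _ -> _]/= [cf_B _ _ _ 0]/= mulr1 mulr0 addr0.
move=> [-> _] BE AE; rewrite AE BE in B0 *; rewrite (negbTE B0).
by congr (Some (_ / _)); rewrite /cf_A /= mulr1; ring.
Qed.

Theorem corollary3p4 (R : realType) (a b q : R[i])
  (hq : `|q| < 1)
  (hb : b != 0)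
  (hbqa : `|b * q| < `|a|)
  (hab : `|a| < 1 / `|b|)
  (hden : qpochhammer (a ^+ 2 * q ^+ 3) (q ^+ 4)
          * qpochhammer (b ^+ 2 * q ^+ 3) (q ^+ 4) != 0)
  (hnum : forall k : nat, (1 <= k)%N -> cf_num a b q k != 0) :
  cf_has_value (cf_num a b q) (cf_den a b q)
    (Some (qpochhammer (a ^+ 2 * q) (q ^+ 4)
           * qpochhammer (b ^+ 2 * q) (q ^+ 4)
           / (qpochhammer (a ^+ 2 * q ^+ 3) (q ^+ 4)
              * qpochhammer (b ^+ 2 * q ^+ 3) (q ^+ 4)))).
Proof.
(* The partial numerator a_2 contains the factor q^2. *)
have q0 : q != 0.
  apply: contraTneq (hnum 2%N isT) => ->.
  by rewrite cf_numS /= (exprS _ 1) mul0r mulr0 eqxx.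
rewrite -lim_AE// -lim_BE// in hden *.
have cA := (cvg_cf_A hq q0 a b).1; have cB := @cvg_cf_B _ _ hq q0 a b.
have z0 := den_prod_neq0 hq q0.
(* The limit of the denominators is nonzero by [hden], so from [N] on they are nonzero and the
   approximants are finite. *)
have [N _ BN] :=
  @cvgr_neq0 R[i] (R[i])^o nat _ eventually_filter _ _ cB hden.
have AB : (fun n => cf_A q a b n.+1 / cf_B q a b n.+1) @ \oo -->
    ((lim_A q a b / lim_B q a b : R[i]) : R[i]^o).
  have cAB := cvgM_complex cA (cvgV_complex hden cB).
  rewrite (_ : (fun n => _) = (fun n => normalized q (cf_A q a b) n.+1 *
    (normalized q (cf_B q a b) n.+1)^-1)); last first.
    by apply/funext => n; rewrite /normalized invfM invrK mulrACA mulVf ?mulr1.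
  exact: (cvg_shiftS_complex _ _).2 cAB.
(* The limit is carried to the sphere by continuity of the inclusion [Some]. *)
have SAB : (fun n => Some (cf_A q a b n.+1 / cf_B q a b n.+1) : Chat R) @ \oo
    --> (Some (lim_A q a b / lim_B q a b) : Chat R).
  exact: (cvg_comp (fun n => cf_A q a b n.+1 / cf_B q a b n.+1) Some AB
    (@one_point_compactification_some_continuous (R[i])^o _)).
apply: cvg_trans SAB; apply: near_eq_cvg; exists N => // n /= Nn.
rewrite cf_approximantE//; have := BN n.+1 (leqW Nn).
by rewrite /normalized mulf_eq0 negb_or => /andP[].
Qed.
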